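(* Let $k\geq 3$ and $n\geq 1$, let $\mathsf{A}\in\mathbb{R}^{n\times n\times\cdots\times n}$ be a $k$th order supersymmetric tensor, and let $\mathbf{x}_0\in\mathbb{R}^n$ be an initial condition. For the multilinear dynamical system $\mathbf{x}_{t+1}=\mathsf{A}\mathbf{x}_t^{k-1}$ started at $\mathbf{x}_0$, the equilibrium point $\mathbf{x}=\mathbf{0}$ is asymptotically stable if $$\|\mathsf{A}\|^{\frac{1}{k-2}}\|\mathbf{x}_0\|<1.$$
   Context: A $k$th order tensor $\mathsf{A}\in\mathbb{R}^{n\times\cdots\times n}$ ($k$ modes, each of size $n$) is supersymmetric if its entries $\mathsf{A}_{j_1j_2\dots j_k}$ are invariant under any permutation of the indices. The vector $\mathsf{A}\mathbf{x}^{k-1}\in\mathbb{R}^n$ is given by $(\mathsf{A}\mathbf{x}^{k-1})_{j}=\sum_{j_1,\dots,j_{k-1}=1}^n\mathsf{A}_{j_1\dots j_{k-1}j}\,\mathbf{x}_{j_1}\cdots\mathbf{x}_{j_{k-1}}$. Time $t=0,1,2,\dots$ is discrete. $\|\mathsf{A}\|$ is the tensor Frobenius norm, $\|\mathsf{A}\|^2=\sum_{j_1,\dots,j_k=1}^n\mathsf{A}_{j_1\dots j_k}^2$; for vectors this is the Euclidean norm. The equilibrium $\mathbf{x}=\mathbf{0}$ is asymptotically stable (for the given initial condition $\mathbf{x}_0$) if the trajectory starting at $\mathbf{x}_0$ satisfies $\mathbf{x}_t\to\mathbf{0}$ as $t\to\infty$. *)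

(* Defs.v *)
From mathcomp Require Import all_boot all_order all_algebra all_fingroup.
From mathcomp Require Import all_classical all_reals all_analysis.

Set Implicit Arguments.
Unset Strict Implicit.
Unset Printing Implicit Defensive.

Import Order.TTheory GRing.Theory Num.Theory.
Import numFieldNormedType.Exports.

Local Open Scope classical_set_scope.
Local Open Scope ring_scope.

Definition tensor (R : Type) (k n : nat) : Type := {ffun k.-tuple 'I_n -> R}.

Definition supersymmetric (R : Type) (k n : nat) (A : tensor R k n) : Prop :=
  forall (s : 'S_k) (J : k.-tuple 'I_n),
    A [tuple tnth J (s i) | i < k] = A J.

(* For k >= 1, [nth j J i] is the i-th entry of J if i < k - 1 and, by default,
   j if i = k - 1, so the index of the tensor entry is (J_1, ..., J_(k-1), j). *)
Definition tensor_apply (R : realType) (k n : nat) (A : tensor R k n)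
    (x : 'cV[R]_n) : 'cV[R]_n :=
  \col_(j < n) \sum_(J : k.-1.-tuple 'I_n)
    A [tuple nth j J i | i < k] * \prod_(i < k.-1) x (tnth J i) 0.

Definition tensor_norm (R : realType) (k n : nat) (A : tensor R k n) : R :=
  Num.sqrt (\sum_(J : k.-tuple 'I_n) A J ^+ 2).

(* The library norm on matrices is the sup norm, not the Euclidean one. *)
Definition vector_norm (R : realType) (n : nat) (x : 'cV[R]_n) : R :=
  Num.sqrt (\sum_(i < n) x i 0 ^+ 2).

Definition trajectory (T : Type) (f : T -> T) (x0 : T) (t : nat) : T :=
  iter t f x0.

(* Asymptotic stability of the equilibrium 0 relative to one given initial
   condition: only the trajectory started at x0 is required to tend to 0. *)
Definition asymptotically_stable_from (R : realType) (n : nat)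
    (f : 'cV[R]_n -> 'cV[R]_n) (x0 : 'cV[R]_n) : Prop :=
  trajectory f x0 t @[t --> \oo] --> (0 : 'cV[R]_n).

(* Main.v *)
Require Import Defs.
From mathcomp Require Import all_boot all_order all_algebra all_fingroup.
From mathcomp Require Import all_classical all_reals all_analysis.
From mathcomp Require Import ring.

Import Order.TTheory GRing.Theory Num.Theory.
Import numFieldNormedType.Exports.

Local Open Scope ring_scope.

(** By Cauchy-Schwarz, |A x^(k-1)| <= |A| |x|^(k-1). Hence the Euclidean norm
    does not increase along the trajectory, and each step multiplies it by at
    most |A| |x_0|^(k-2) = (|A|^(1/(k-2)) |x_0|)^(k-2) < 1. *)

Lemma sumr_Cauchy_Schwarz (R : realFieldType) (I : finType) (f g : I -> R) :
  (\sum_i f i * g i) ^+ 2 <= (\sum_i f i ^+ 2) * (\sum_i g i ^+ 2).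
Proof.
have: 0 <= \sum_i \sum_j (f i * g j - f j * g i) ^+ 2.
  by apply: sumr_ge0 => i _; apply: sumr_ge0 => j _; exact: sqr_ge0.
(* Lagrange's identity *)
suff -> : \sum_i \sum_j (f i * g j - f j * g i) ^+ 2 =
    2 * ((\sum_i f i ^+ 2) * (\sum_i g i ^+ 2) - (\sum_i f i * g i) ^+ 2).
  by rewrite pmulr_rge0 // subr_ge0.
have -> : \sum_i \sum_j (f i * g j - f j * g i) ^+ 2 =
    \sum_i \sum_j f i ^+ 2 * g j ^+ 2 + \sum_i \sum_j f j ^+ 2 * g i ^+ 2
    - 2 * \sum_i \sum_j (f i * g i) * (f j * g j).
  rewrite mulr_sumr -big_split -sumrB; apply: eq_bigr => i _ /=.
  rewrite mulr_sumr -big_split -sumrB; apply: eq_bigr => j _ /=; ring.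
rewrite [X in _ + X - _]exchange_big /= -!big_distrlr /=; ring.
Qed.

(** Expanding the power picks one summand from each of the [m] factors, and the picks form a tuple.
    With [f i] the square of [x i 0], this turns |x|^(2m) into the sum of the squared monomials
    occurring in [tensor_apply]. *)
Lemma sum_tuple_prod (R : comRingType) (n m : nat) (f : 'I_n -> R) :
  \sum_(J : m.-tuple 'I_n) \prod_(i < m) f (tnth J i) = (\sum_i f i) ^+ m.
Proof.
rewrite -[in RHS](card_ord m) -prodr_const bigA_distr_bigA /=.
rewrite (reindex (@tuple_of_finfun _ m)) /=; last first.
  exists (@finfun_of_tuple _ m) => ? _;
    [exact: tuple_of_finfunK | exact: finfun_of_tupleK].
by apply: eq_bigr => h _; apply: eq_bigr => i _; rewrite tnth_mktuple.
Qed.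

(** Appending [j] to [J] is a bijection onto the longer tuples. It reassembles the squared norm of
    the tensor from its slices at a fixed output coordinate [j]. *)
Lemma sum_tuple_rcons (R : nmodType) (n m : nat)
    (F : m.+1.-tuple 'I_n -> R) :
  \sum_(j < n) \sum_(J : m.-tuple 'I_n) F [tuple nth j J i | i < m.+1] =
  \sum_J F J.
Proof.
rewrite pair_big /=.
rewrite [RHS](reindex (fun p : 'I_n * m.-tuple 'I_n =>
  [tuple nth p.1 p.2 i | i < m.+1])) //=.
exists (fun J : m.+1.-tuple 'I_n =>
  (tnth J ord_max, [tuple tnth J (widen_ord (leqnSn m) i) | i < m])).
- move=> [j J] _ /=; congr pair.
    by rewrite tnth_mktuple nth_default // size_tuple.
  apply: eq_from_tnth => i; rewrite !tnth_mktuple /=.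
  by rewrite -tnth_nth.
- move=> J _; apply: eq_from_tnth => i; rewrite tnth_mktuple /=.
  have [im|mi] := ltnP i m.
    rewrite (nth_map (Ordinal im)) ?size_enum_ord //; congr (tnth J _).
    by apply: val_inj; rewrite /= nth_enum_ord.
  (* Here [i] is the last position, just past the end of the truncated tuple, so [nth] returns its
     default, the last entry of [J]. *)
  rewrite nth_default; last by rewrite size_map size_enum_ord.
  congr (tnth J _).
  by apply: val_inj; apply/eqP; rewrite eqn_leq mi -ltnS ltn_ord.
Qed.

Section Norms.
Variable R : realType.

Lemma vector_norm_ge0 (n : nat) (x : 'cV[R]_n) : 0 <= vector_norm x.
Proof. exact: sqrtr_ge0. Qed.

Lemma sqr_vector_norm (n : nat) (x : 'cV[R]_n) :
  vector_norm x ^+ 2 = \sum_i x i 0 ^+ 2.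
Proof. by rewrite sqr_sqrtr// sumr_ge0// => i _; exact: sqr_ge0. Qed.

Lemma sqr_tensor_norm (k n : nat) (A : tensor R k n) :
  tensor_norm A ^+ 2 = \sum_J A J ^+ 2.
Proof. by rewrite sqr_sqrtr// sumr_ge0// => J _; exact: sqr_ge0. Qed.

(** This transfers Euclidean bounds to the sup norm, in which convergence is proved: the square of
    each entry is one term of the Euclidean sum. *)
Lemma norm_le_vector_norm (n : nat) (x : 'cV[R]_n) : `|x| <= vector_norm x.
Proof.
rewrite /Num.Def.normr /= mx_normrE; apply/bigmax_leP; split=> [|[i j] _ /=].
  exact: vector_norm_ge0.
rewrite ord1 -sqrtr_sqr ler_wsqrtr// (bigD1 i)//= lerDl.
by apply: sumr_ge0 => l _; exact: sqr_ge0.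
Qed.

(** Cauchy-Schwarz is applied for each output coordinate [j] separately. The factor coming from the
    monomials is the same for every [j], so summing over [j] only reassembles the tensor norm. *)
Lemma tensor_apply_norm_le (m n : nat) (A : tensor R m.+1 n) (x : 'cV[R]_n) :
  vector_norm (tensor_apply A x) <= tensor_norm A * vector_norm x ^+ m.
Proof.
rewrite -ler_sqr ?nnegrE ?mulr_ge0 ?exprn_ge0 ?sqrtr_ge0//.
rewrite exprMn exprAC sqr_tensor_norm !sqr_vector_norm.
rewrite -sum_tuple_prod -sum_tuple_rcons mulr_suml.
apply: ler_sum => j _; rewrite mxE.
apply: (le_trans (sumr_Cauchy_Schwarz _ _ _ _)).
by under [X in _ * X <= _]eq_bigr do rewrite -prodrXl.
Qed.

Lemma trajectory_norm_le (m n : nat) (A : tensor R m.+2 n) (x0 : 'cV[R]_n)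
    (q := tensor_norm A * vector_norm x0 ^+ m) (t : nat) :
  q <= 1 ->
  vector_norm (trajectory (tensor_apply A) x0 t) <= q ^+ t * vector_norm x0.
Proof.
move=> q1.
have q0 : 0 <= q by rewrite mulr_ge0 ?exprn_ge0 ?sqrtr_ge0.
rewrite /trajectory; elim: t => [|t IH]; first by rewrite mul1r.
rewrite iterS; move: IH; set y := iter _ _ _ => IH.
rewrite (le_trans (tensor_apply_norm_le _ _ _ _))//.
have yx0 : vector_norm y <= vector_norm x0.
  by rewrite (le_trans IH)// ler_piMl ?vector_norm_ge0// exprn_ile1.
(* One factor |y| is split off and bounded by [IH]; the other [m] factors are bounded by |x0|, which
   together with |A| gives [q]. *)
rewrite exprSr mulrA [in leRHS]exprS -[leRHS]mulrA.
rewrite ler_pM ?mulr_ge0 ?exprn_ge0 ?sqrtr_ge0//.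
by rewrite ler_wpM2l ?sqrtr_ge0// lerXn2r ?nnegrE ?sqrtr_ge0.
Qed.

End Norms.

Theorem proposition3 (R : realType) (k n : nat) (hk : (3 <= k)%N)
    (hn : (1 <= n)%N) (A : tensor R k n) (hA : supersymmetric A)
    (x0 : 'cV[R]_n) :
  tensor_norm A `^ (1 / (k%:R - 2)) * vector_norm x0 < 1 ->
  asymptotically_stable_from (tensor_apply A) x0.
Proof.
case: k hk A hA => [|[|[|m]]]// _ A _.
have -> : m.+3%:R - 2 = m.+1%:R :> R by rewrite -addn2 natrD addrK.
rewrite div1r => small.
pose q := tensor_norm A * vector_norm x0 ^+ m.+1.
have q0 : 0 <= q by rewrite mulr_ge0 ?exprn_ge0 ?sqrtr_ge0.
have q1 : q < 1.
  (* The power k - 2 = m + 1 undoes the root in the hypothesis; as this exponent is nonzero, the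
     power of a number in [0, 1) stays below 1. *)
  have -> : q = (tensor_norm A `^ m.+1%:R^-1 * vector_norm x0) ^+ m.+1.
    by rewrite exprMn -powR_mulrn ?powR_ge0// -powRrM mulVf// powRr1 ?sqrtr_ge0.
  by rewrite exprn_ilt1// mulr_ge0 ?powR_ge0 ?sqrtr_ge0.
apply: norm_cvg0.
(* The sup norm of the state is squeezed between 0 and |x0| q^t. *)
apply: (@squeeze_cvgr _ _ _ _ (fun=> 0) (geometric (vector_norm x0) q)).
- near=> t; rewrite normr_ge0 /= (le_trans (norm_le_vector_norm _ _ _))//.
  by rewrite mulrC; apply: trajectory_norm_le; exact: ltW.
- exact: cvg_cst.
- by apply: cvg_geometric; rewrite ger0_norm.
Unshelve. all: by end_near.
Qed.
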